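(* Let $0\leq\mu_x<L_x<\infty$, $0\leq\mu_y<L_y<\infty$, $0\leq L_{xy}<\infty$, let $I$ be a finite nonempty index set, and let $A_I=\{(x_i,y_i,g^x_i,g^y_i,f_i)\}_{i\in I}$ with $x_i,g^x_i\in\mathbb{R}^{d_x}$, $y_i,g^y_i\in\mathbb{R}^{d_y}$, $f_i\in\mathbb{R}$. Then $A_I$ is $\mathcal{K}_{\mu_x,\mu_y,L_x,L_y,L_{xy}}$-interpolable if and only if for every $i\in I$ there exist $h^x_i,\phi^x_i\in\mathbb{R}^{d_x}$, $h^y_i,\phi^y_i\in\mathbb{R}^{d_y}$ and $f^x_i,f^y_i\in\mathbb{R}$ such that, for all $i,j\in I$, $$f_i=f^x_i+\langle h^x_i,x_i\rangle-f^y_i,\qquad g^x_i=\phi^x_i+h^x_i,\qquad g^y_i=h^y_i-\phi^y_i,$$ $$f^x_i\geq f^x_j+\langle\phi^x_j,x_i-x_j\rangle+\frac{L_x}{2(L_x-\mu_x)}\left(\frac{1}{L_x}\|\phi^x_i-\phi^x_j\|_2^2+\mu_x\|x_i-x_j\|_2^2-2\frac{\mu_x}{L_x}\langle\phi^x_i-\phi^x_j,x_i-x_j\rangle\right),$$ $$f^y_i\geq f^y_j+\langle\phi^y_j,y_i-y_j\rangle+\frac{L_y}{2(L_y-\mu_y)}\left(\frac{1}{L_y}\|\phi^y_i-\phi^y_j\|_2^2+\mu_y\|y_i-y_j\|_2^2-2\frac{\mu_y}{L_y}\langle\phi^y_i-\phi^y_j,y_i-y_j\rangle\right),$$ and $$H_x^\top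 X=Y^\top H_y,\qquad H_x^\top H_x\preceq L_{xy}^2\,Y^\top Y,\qquad H_y^\top H_y\preceq L_{xy}^2\,X^\top X,$$ where $X,Y,H_x,H_y$ are the matrices having $\{x_i\}_{i\in I}$, $\{y_i\}_{i\in I}$, $\{h^x_i\}_{i\in I}$, $\{h^y_i\}_{i\in I}$ as columns, respectively (in the same order).
   Context: For $0\leq\mu\leq L$, $L>0$, $\mathcal{F}_{\mu,L}$ is the class of functions $p:\mathbb{R}^d\to\mathbb{R}$ such that $p(x)-\frac{\mu}{2}\|x\|_2^2$ is convex and $p$ is differentiable with $L$-Lipschitz gradient. $\mathcal{K}_{\mu_x,\mu_y,L_x,L_y,L_{xy}}$ is the class of functions $f:\mathbb{R}^{d_x}\times\mathbb{R}^{d_y}\to\mathbb{R}$ of the form $f(x,y)=p(x)+y^\top A x-q(y)$ with $p\in\mathcal{F}_{\mu_x,L_x}$ on $\mathbb{R}^{d_x}$, $q\in\mathcal{F}_{\mu_y,L_y}$ on $\mathbb{R}^{d_y}$, and $A\in\mathbb{R}^{d_y\times d_x}$ with largest singular value $\sigma_{\max}(A)\leq L_{xy}$. $A_I$ is $\mathcal{K}_{\mu_x,\mu_y,L_x,L_y,L_{xy}}$-interpolable if there exists $f$ in this class with $g^x_i=\nabla_x f(x_i,y_i)$, $g^y_i=\nabla_y f(x_i,y_i)$, $f_i=f(x_i,y_i)$ for all $i\in I$. The symbol $\preceq$ denotes the Loewner order on symmetric matrices. *)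

(* Defs.v *)
From HB Require Import structures.
From mathcomp Require Export all_boot all_order all_algebra.
From mathcomp Require Export all_classical all_reals all_analysis.

Set Implicit Arguments.
Unset Strict Implicit.
Unset Printing Implicit Defensive.

Import Order.TTheory GRing.Theory Num.Theory.
Import numFieldNormedType.Exports.

Local Open Scope classical_set_scope.
Local Open Scope ring_scope.

Definition dotv (R : realType) (d : nat) (u v : 'cV[R]_d) : R :=
  (u^T *m v) 0 0.

(* The library norm `|u| on matrices is the sup norm, hence a separate
   Euclidean norm. *)
Definition norm2 (R : realType) (d : nat) (u : 'cV[R]_d) : R :=
  Num.sqrt (dotv u u).

(* A total function, equal to the gradient wherever f is differentiable.
   Differentiability on a finite-dimensional space does not depend on the
   norm, so the library notion (for the sup norm) is the usual one. *)
Definition grad (R : realType) (d : nat) (f : 'cV[R]_d -> R) (x : 'cV[R]_d) :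
    'cV[R]_d :=
  \col_k 'D_(delta_mx k 0) f x.

Definition classF (R : realType) (d : nat) (mu L : R) (p : 'cV[R]_d -> R) :
    Prop :=
  [/\ convex_function (E := 'cV[R]_d) setT
        (fun x : 'cV[R]_d => p x - mu / 2 * norm2 x ^+ 2),
      forall x, differentiable p x &
      forall x y, norm2 (grad p x - grad p y) <= L * norm2 (x - y)].

(* Singular values are the square roots of the eigenvalues of A^T A. There are
   finitely many of them, so the supremum is a maximum when n > 0; it is 0 by
   convention of sup when n = 0. *)
Definition sigma_max (R : realType) (m n : nat) (A : 'M[R]_(m, n)) : R :=
  sup [set Num.sqrt a | a in [set a : R | eigenvalue (A^T *m A) a]].

Definition classK (R : realType) (dx dy : nat) (mux muy Lx Ly Lxy : R)
    (f : 'cV[R]_dx * 'cV[R]_dy -> R) : Prop :=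
  exists (p : 'cV[R]_dx -> R) (q : 'cV[R]_dy -> R) (A : 'M[R]_(dy, dx)),
    [/\ classF mux Lx p, classF muy Ly q, sigma_max A <= Lxy &
        forall x y, f (x, y) = p x + (y^T *m A *m x) 0 0 - q y].

Definition interpolable (R : realType) (dx dy : nat) (mux muy Lx Ly Lxy : R)
    (I : finType) (x : I -> 'cV[R]_dx) (y : I -> 'cV[R]_dy)
    (gx : I -> 'cV[R]_dx) (gy : I -> 'cV[R]_dy) (fv : I -> R) : Prop :=
  exists f : 'cV[R]_dx * 'cV[R]_dy -> R,
    classK mux muy Lx Ly Lxy f /\
    forall i : I, [/\ gx i = grad (fun x' => f (x', y i)) (x i),
                      gy i = grad (fun y' => f (x i, y')) (y i) &
                      fv i = f (x i, y i)].

(* The columns are listed in the order of the enumeration of I, the same for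
   every family. *)
Definition colsmx (R : realType) (I : finType) (d : nat) (v : I -> 'cV[R]_d) :
    'M[R]_(d, #|I|) :=
  \matrix_(k, j) v (enum_val j) k 0.

Definition psdmx (R : realType) (n : nat) (M : 'M[R]_n) : Prop :=
  M^T = M /\ forall v : 'cV[R]_n, 0 <= (v^T *m M *m v) 0 0.

Definition loewner_le (R : realType) (n : nat) (M N : 'M[R]_n) : Prop :=
  psdmx (N - M).

(* The interpolation inequality of F_{mu,L} for the ordered pair whose data
   are (x, g, f) and (x', g', f'). *)
Definition interpF (R : realType) (d : nat) (mu L : R)
    (x g : 'cV[R]_d) (f : R) (x' g' : 'cV[R]_d) (f' : R) : Prop :=
  f >= f' + dotv g' (x - x')
       + L / (2 * (L - mu))
         * (1 / L * norm2 (g - g') ^+ 2 + mu * norm2 (x - x') ^+ 2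
            - 2 * (mu / L) * dotv (g - g') (x - x')).

(* Main.v *)
From HB Require Import structures.
Require Import Defs.
From mathcomp Require Import ring lra.
Set Implicit Arguments.
Unset Strict Implicit.
Unset Printing Implicit Defensive.
Import Order.TTheory GRing.Theory Num.Theory.
Import numFieldNormedType.Exports.
Local Open Scope ring_scope.

(** Write f_i = p(x_i) + <A^T y_i, x_i> - q(y_i), so that the data split into
  interpolation problems for p, for q and for the matrix A.

  For p, subtracting mu/2 |x|^2 reduces to a convex function h with
  h <= its tangents + l/2 |.|^2, l = L - mu.  Necessity compares both bounds at
  x - (h'(x) - h'(y)) / l.  Conversely the interpolant is
  h(z) = max over the simplex of
    sum_i a_i (f_i + <g_i, z - x_i> + |g_i|^2/2l) - |sum_i a_i g_i|^2/2l.
  It is convex as a maximum of affine functions, and l/2 |z|^2 - h(z) is convex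
  as a partial minimum of a jointly convex function; a maximiser supplies a
  subgradient, and the two convexities make it a Lipschitz gradient.

  For A, the conditions say that x_i |-> h^y_i and y_i |-> h^x_i define
  compatible maps of norm at most L_xy on the spans, and a common extension of
  the same norm is built as in Parrott's theorem. *)

(** * The Euclidean inner product and positive semidefinite matrices *)

Section Dotv.
Variables (R : realType) (d : nat).
Implicit Types (u v w : 'cV[R]_d) (a : R).

Lemma dotvE u v : dotv u v = \sum_i u i 0 * v i 0.
Proof. by rewrite /dotv mxE; apply: eq_bigr => i _; rewrite mxE. Qed.

Lemma dotvC u v : dotv u v = dotv v u.
Proof. by rewrite !dotvE; apply: eq_bigr => i _; rewrite mulrC. Qed.

Lemma dotvDl u v w : dotv (u + v) w = dotv u w + dotv v w.
Proof. by rewrite /dotv linearD/= mulmxDl mxE. Qed.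

Lemma dotvDr u v w : dotv u (v + w) = dotv u v + dotv u w.
Proof. by rewrite /dotv mulmxDr mxE. Qed.

Lemma dotvNl u v : dotv (- u) v = - dotv u v.
Proof. by rewrite /dotv linearN/= mulNmx mxE. Qed.

Lemma dotvNr u v : dotv u (- v) = - dotv u v.
Proof. by rewrite /dotv mulmxN mxE. Qed.

Lemma dotvZl a u v : dotv (a *: u) v = a * dotv u v.
Proof. by rewrite /dotv linearZ/= -scalemxAl mxE. Qed.

Lemma dotvZr a u v : dotv u (a *: v) = a * dotv u v.
Proof. by rewrite /dotv -scalemxAr mxE. Qed.

Definition dotv_bilin := (dotvDl, dotvDr, dotvNl, dotvNr, dotvZl, dotvZr).

Lemma dotv0l u : dotv 0 u = 0.
Proof. by rewrite -(scale0r 0) dotvZl mul0r. Qed.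

Lemma dotv0r u : dotv u 0 = 0.
Proof. by rewrite dotvC dotv0l. Qed.

Lemma dotv_suml (I : finType) (F : I -> 'cV[R]_d) u :
  dotv (\sum_i F i) u = \sum_i dotv (F i) u.
Proof. by rewrite /dotv linear_sum/= mulmx_suml summxE. Qed.

Lemma dotv_ge0 u : 0 <= dotv u u.
Proof. by rewrite dotvE sumr_ge0// => i _; rewrite -expr2 sqr_ge0. Qed.

Lemma dotv_eq0 u : (dotv u u == 0) = (u == 0).
Proof.
apply/idP/eqP => [|->]; last by rewrite dotv0l.
rewrite dotvE psumr_eq0; last by move=> i _; rewrite -expr2 sqr_ge0.
move=> /allP u0; apply/matrixP => i j; rewrite ord1 mxE; apply/eqP.
by have := u0 i; rewrite mem_index_enum mulf_eq0 orbb; apply.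
Qed.

Lemma norm2_sqr u : norm2 u ^+ 2 = dotv u u.
Proof. by rewrite sqr_sqrtr ?dotv_ge0. Qed.

Lemma norm2_ge0 u : 0 <= norm2 u.
Proof. exact: sqrtr_ge0. Qed.

Lemma dotv_delta i u : dotv (delta_mx i 0) u = u i 0.
Proof. by rewrite /dotv trmx_delta -rowE mxE. Qed.

End Dotv.

Lemma dotv_mulmx (R : realType) (m n : nat) (A : 'M[R]_(m, n)) u v :
  dotv (A *m u) v = dotv u (A^T *m v).
Proof. by rewrite /dotv trmx_mul mulmxA. Qed.

(** The quadratic is evaluated at its minimiser [- b / c]; for [c = 0] it is affine and stays
    nonnegative only if [b = 0]. *)
Lemma discr_le0 (R : realFieldType) (a b c : R) : 0 <= c ->
  (forall t, 0 <= a + 2 * t * b + t ^+ 2 * c) -> b ^+ 2 <= a * c.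
Proof.
rewrite le_eqVlt => /predU1P[<-|c0] H; last first.
  have := H (- b / c); rewrite -(pmulr_rge0 _ c0).
  suff -> : c * (a + 2 * (- b / c) * b + (- b / c) ^+ 2 * c) = a * c - b ^+ 2.
    by rewrite subr_ge0.
  by field; rewrite gt_eqF.
have [->|b0] := eqVneq b 0; first by rewrite mulr0 expr0n.
(* The affine function takes the value -1 here. *)
have := H (- (a + 1) / (2 * b)).
suff -> : a + 2 * (- (a + 1) / (2 * b)) * b + (- (a + 1) / (2 * b)) ^+ 2 * 0 = -1.
  by lra.
by field.
Qed.

Section Psd.
Variables (R : realType) (d : nat) (M : 'M[R]_d).
Hypothesis symM : M^T = M.
Hypothesis psdM : forall v : 'cV[R]_d, 0 <= dotv v (M *m v).

Lemma dotv_sym u v : dotv u (M *m v) = dotv v (M *m u).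
Proof. by rewrite -{1}symM -dotv_mulmx dotvC. Qed.

Lemma psd_cauchy_schwarz u v :
  dotv u (M *m v) ^+ 2 <= dotv u (M *m u) * dotv v (M *m v).
Proof.
apply: discr_le0 => // t; have := psdM (u + t *: v).
rewrite mulmxDr -scalemxAr !dotv_bilin (dotv_sym v u).
by congr (0 <= _); ring.
Qed.

(** Cauchy-Schwarz for the form [M], at [M *m v] and [v], bounds |M v|^4 by zero. *)
Lemma psd_kernel v : dotv v (M *m v) = 0 -> M *m v = 0.
Proof.
move=> v0; have := psd_cauchy_schwarz (M *m v) v.
rewrite v0 mulr0 => H; apply/eqP; rewrite -dotv_eq0.
by rewrite -sqrf_eq0 eq_le H sqr_ge0.
Qed.

End Psd.

Lemma cauchy_schwarz (R : realType) (d : nat) (u v : 'cV[R]_d) :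
  dotv u v ^+ 2 <= dotv u u * dotv v v.
Proof.
have := @psd_cauchy_schwarz R d 1%:M (trmx1 _ _) _ u v; rewrite !mul1mx; apply.
by move=> w; rewrite mul1mx dotv_ge0.
Qed.

Lemma dotv_le_norm2 (R : realType) (d : nat) (u v : 'cV[R]_d) :
  dotv u v <= norm2 u * norm2 v.
Proof.
rewrite (le_trans (ler_norm _))// -ler_sqr ?nnegrE ?mulr_ge0 ?norm2_ge0//.
by rewrite real_normK ?num_real// exprMn !norm2_sqr cauchy_schwarz.
Qed.

Lemma norm2D (R : realType) (d : nat) (u v : 'cV[R]_d) :
  norm2 (u + v) <= norm2 u + norm2 v.
Proof.
rewrite -ler_sqr ?nnegrE ?addr_ge0 ?norm2_ge0// sqrrD !norm2_sqr.
by rewrite !dotv_bilin (dotvC v u); have := dotv_le_norm2 u v; lra.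
Qed.

Lemma norm2Z (R : realType) (d : nat) a (u : 'cV[R]_d) :
  0 <= a -> norm2 (a *: u) = a * norm2 u.
Proof.
by move=> a0; rewrite /norm2 !dotv_bilin mulrA -expr2 sqrtrM ?sqr_ge0// sqrtr_sqr ger0_norm.
Qed.

(** Cauchy-Schwarz divided by [dotv u u]. With u = A^T v and w = A u it bounds the adjoint of [A]; a
    second use bounds the extension [S] in [contraction_interpolation]. *)
Lemma dotv_self_le (R : realType) (m n : nat) (K : R) (u : 'cV[R]_m) (v w : 'cV[R]_n) :
  0 <= K -> dotv u u = dotv v w -> dotv w w <= K * dotv u u ->
  dotv u u <= K * dotv v v.
Proof.
move=> K0 uvw wu; have := dotv_ge0 v; have := dotv_ge0 u.
rewrite le_eqVlt => /predU1P[<- v0|u0 v0]; first by rewrite mulr_ge0.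
rewrite -(ler_pM2l u0) -expr2 {1}uvw (le_trans (cauchy_schwarz v w))//.
by rewrite (le_trans (ler_wpM2l v0 wu))// mulrCA [X in _ <= X]mulrCA [_ * dotv v v]mulrC.
Qed.

(** * Extension of linear maps under a norm bound *)

Lemma trmx_contraction (R : realType) (m n : nat) (K : R) (A : 'M[R]_(m, n)) :
  0 <= K -> (forall v : 'cV[R]_n, dotv (A *m v) (A *m v) <= K * dotv v v) ->
  forall v : 'cV[R]_m, dotv (A^T *m v) (A^T *m v) <= K * dotv v v.
Proof.
move=> K0 AK v; apply: dotv_self_le (AK (A^T *m v)) => //.
by rewrite dotv_mulmx trmxK.
Qed.

(** Fredholm alternative: the columns of [B] lie in the range of [A] once they are orthogonal to the
    kernel of [A^T], which the cokernel matrix spans. *)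
Lemma mulmx_solvable (F : fieldType) (m n k : nat) (A : 'M[F]_(m, n)) (B : 'M[F]_(m, k)) :
  (forall v : 'cV[F]_m, A^T *m v = 0 -> B^T *m v = 0) -> exists C, A *m C = B.
Proof.
move=> AB; have /submxP[D BD] : (B^T <= A^T)%MS.
  rewrite submxE; apply/eqP/matrixP => i j.
  have : B^T *m col j (cokermx A^T) = 0.
    by apply: AB; rewrite colE mulmxA mulmx_coker mul0mx.
  by rewrite colE mulmxA -colE => /matrixP/(_ i 0); rewrite !mxE.
by exists D^T; rewrite -[A]trmxK -trmx_mul -BD trmxK.
Qed.

(* S is the extension of Y v |-> Hx v to the whole space that is minimal, and
   M measures its defect of contractivity; C moves a vector along the range of
   X to the minimiser W of the form M, which is where the two prescribed
   actions have to be reconciled. *)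
Lemma contraction_interpolation (R : realType) (m n k : nat) (L : R)
    (X Hx : 'M[R]_(m, k)) (Y Hy : 'M[R]_(n, k)) :
  0 <= L -> Hx^T *m X = Y^T *m Hy ->
  (forall v : 'cV[R]_k, dotv (Hx *m v) (Hx *m v) <= L ^+ 2 * dotv (Y *m v) (Y *m v)) ->
  (forall v : 'cV[R]_k, dotv (Hy *m v) (Hy *m v) <= L ^+ 2 * dotv (X *m v) (X *m v)) ->
  exists A : 'M[R]_(n, m), [/\ A *m X = Hy, A^T *m Y = Hx &
    forall v : 'cV[R]_m, dotv (A *m v) (A *m v) <= L ^+ 2 * dotv v v].
Proof.
move=> L0 XY HxY HyX.
(* Normal equations: [Y^T *m Y] and [Y] have the same kernel, and [Hx] vanishes there by [HxY]. *)
have [P YP] : exists P, (Y^T *m Y) *m P = Hx^T.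
  apply: mulmx_solvable => v; rewrite trmx_mul trmxK -mulmxA => YYv.
  have Yv : dotv (Y *m v) (Y *m v) = 0 by rewrite dotv_mulmx YYv dotv0r.
  rewrite trmxK; apply/eqP; rewrite -dotv_eq0 eq_le dotv_ge0 andbT.
  by rewrite (le_trans (HxY v))// Yv mulr0.
have [S SE] : exists S, S = Y *m P by exists (Y *m P).
have YS : Y^T *m S = Hx^T by rewrite SE mulmxA.
have SY : S^T *m Y = Hx by rewrite -[Y]trmxK -trmx_mul YS trmxK.
(* Here |S w|^2 = <w, Hx P w>, while |Hx P w|^2 <= L^2 |S w|^2 by [HxY]. *)
have Sle (w : 'cV_m) : dotv (S *m w) (S *m w) <= L ^+ 2 * dotv w w.
  have h1 : dotv (S *m w) (S *m w) = dotv w (Hx *m (P *m w)).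
    by rewrite dotv_mulmx -SY SE !mulmxA.
  apply: dotv_self_le h1 _; first exact: sqr_ge0.
  by have := HxY (P *m w); rewrite [Y *m _]mulmxA -SE.
pose M := (L ^+ 2)%:M - S^T *m S.
have symM : M^T = M by rewrite linearB/= tr_scalar_mx trmx_mul trmxK.
have ME (v w : 'cV_m) : dotv v (M *m w) = L ^+ 2 * dotv v w - dotv (S *m v) (S *m w).
  by rewrite mulmxBl mul_scalar_mx !dotv_bilin -mulmxA dotv_mulmx.
have psdM (v : 'cV_m) : 0 <= dotv v (M *m v) by rewrite ME subr_ge0 Sle.
(* Normal equations for the semidefinite form [M]: if [X *m v] is isotropic, then M X v = 0 by
   [psd_kernel]. *)
have [C XMC] : exists C, (X^T *m M *m X) *m C = - (X^T *m M).
  apply: mulmx_solvable => v; rewrite !trmx_mul symM trmxK mulmxA => XMXv.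
  have Xv : dotv (X *m v) (M *m (X *m v)) = 0.
    by rewrite dotv_mulmx !mulmxA XMXv dotv0r.
  by rewrite linearN/= trmx_mul symM trmxK mulNmx -mulmxA (psd_kernel symM psdM Xv) oppr0.
pose W := X *m C + 1%:M.
have XMW : X^T *m M *m W = 0 by rewrite mulmxDr mulmx1 mulmxA XMC addNr.
(* Since t = W t - X C t, a map that acts as [S] on W t and sends X c to Hy c has to be this one. *)
pose A := S *m W - Hy *m C.
have YA : Y^T *m A = Hx^T.
  rewrite mulmxBr mulmxA YS mulmxA -XY mulmxDr mulmx1 mulmxA.
  by rewrite [X in X - _]addrC addrK.
(* One bound on pairs (t, c), read as t + X c, serves twice: pairs with t + X c = 0 force A X = Hy,
   and c = 0 gives the norm bound. *)
have Ale (t : 'cV_m) (c : 'cV_k) : dotv (A *m t + Hy *m c) (A *m t + Hy *m c)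
    <= L ^+ 2 * dotv (t + X *m c) (t + X *m c).
  pose u := W *m t; pose v := c - C *m t.
  have -> : A *m t + Hy *m c = S *m u + Hy *m v.
    by rewrite mulmxBl mulmxBr !mulmxA -!addrA [- _ + _]addrC.
  have -> : t + X *m c = u + X *m v.
    rewrite /u /v mulmxDl mulmxBr mul1mx !mulmxA.
    by rewrite [RHS]addrC addrA subrK addrC.
  (* The ranges of [W] and [X] are orthogonal for [M], so the cross terms agree and the bound splits
     into [psdM u] and [HyX v]. *)
  have cross : dotv (S *m u) (Hy *m v) = L ^+ 2 * dotv u (X *m v).
    have -> : dotv (S *m u) (Hy *m v) = dotv (S *m u) (S *m (X *m v)).
      rewrite 2!dotv_mulmx; congr (dotv _ _).
      by rewrite SE trmx_mul -!mulmxA (mulmxA Y^T Hy) -XY -YS SE -!mulmxA.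
    apply/eqP; rewrite eq_sym -subr_eq0 -ME (dotv_sym symM) dotv_mulmx.
    by rewrite !mulmxA XMW mul0mx dotv0r.
  have := psdM u; rewrite ME; have := HyX v.
  rewrite !dotv_bilin (dotvC (Hy *m v)) (dotvC (X *m v) u) cross; lra.
exists A; split.
- apply/matrixP => i j; have := Ale (X *m delta_mx j (0 : 'I_1)) (- delta_mx j 0).
  rewrite !mulmxN subrr dotv0l mulr0 => H.
  have /eqP : A *m (X *m delta_mx j (0 : 'I_1)) - Hy *m delta_mx j 0 == 0.
    by rewrite -dotv_eq0 eq_le H dotv_ge0.
  by rewrite mulmxA -!colE => /subr0_eq/matrixP/(_ i 0); rewrite !mxE.
- by rewrite -[Y]trmxK -trmx_mul YA trmxK.
- by move=> v; have := Ale v 0; rewrite !mulmx0 !addr0.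
Qed.

(** * The largest singular value as an operator norm *)

(** The constant is the squared Frobenius norm; Cauchy-Schwarz is applied row by row. *)
Lemma mulmx_bounded (R : realType) (m n : nat) (A : 'M[R]_(m, n)) :
  exists2 K, 0 <= K &
    forall v : 'cV[R]_n, dotv (A *m v) (A *m v) <= K * dotv v v.
Proof.
exists (\sum_i dotv (row i A)^T (row i A)^T).
  by apply: sumr_ge0 => i _; exact: dotv_ge0.
move=> v; rewrite [X in X <= _]dotvE mulr_suml ler_sum// => i _.
suff -> : (A *m v) i 0 = dotv (row i A)^T v by rewrite -expr2 cauchy_schwarz.
by rewrite /dotv trmxK -row_mul [RHS]mxE.
Qed.

(** Library eigenvectors are rows; symmetry lets transposition turn them into columns. *)
Lemma eigenvalue_symP (R : realType) (n : nat) (B : 'M[R]_n) a : B^T = B ->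
  reflect (exists2 v : 'cV[R]_n, B *m v = a *: v & v != 0) (eigenvalue B a).
Proof.
move=> symB; apply: (iffP eigenvalueP) => -[v vB v0]; exists v^T.
- by rewrite -[B in LHS]symB -trmx_mul vB linearZ/=.
- by rewrite trmx_eq0.
- by rewrite -[B in LHS]symB -trmx_mul vB linearZ/=.
- by rewrite trmx_eq0.
Qed.

(* The least s with B <= s I is an eigenvalue: otherwise s I - B would be
   invertible, hence positive definite, and s could be decreased. *)
Lemma max_eigenvalue (R : realType) (n : nat) (B : 'M[R]_n) : B^T = B ->
  (exists K, forall v : 'cV[R]_n, dotv v (B *m v) <= K * dotv v v) ->
  exists s, [/\ 0 <= s, s = 0 \/ eigenvalue B s &
    forall v : 'cV[R]_n, dotv v (B *m v) <= s * dotv v v].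
Proof.
move=> symB [K KB].
(* Requiring 0 <= s bounds [S] below in every dimension, at the price of the alternative s = 0. *)
pose S := [set s | 0 <= s /\ forall v : 'cV[R]_n, dotv v (B *m v) <= s * dotv v v]%classic.
have S0 : (S !=set0)%classic.
  exists (Num.max 0 K); split; first by rewrite le_max lexx.
  by move=> v; rewrite (le_trans (KB v))// ler_wpM2r ?dotv_ge0// le_max lexx orbT.
have lbS : has_lbound S by exists 0 => s [].
pose s := inf S.
have s0 : 0 <= s by apply: lb_le_inf => // t [].
have sS (v : 'cV_n) : dotv v (B *m v) <= s * dotv v v.
  have [->|v0] := eqVneq v 0; first by rewrite !dotv0l mulr0.
  have vv : 0 < dotv v v by rewrite lt_def dotv_eq0 v0 dotv_ge0.
  rewrite -ler_pdivrMr//; apply: lb_le_inf => // t [_ tB].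
  by rewrite ler_pdivrMr.
exists s; split=> //; move: s0; rewrite le_eqVlt => /predU1P[<-|sp]; first by left.
right; apply: contraT => /negP nev.
pose M := s%:M - B.
have Mv (v : 'cV_n) : M *m v = s *: v - B *m v by rewrite mulmxBl mul_scalar_mx.
have symM : M^T = M by rewrite linearB/= tr_scalar_mx symB.
have psdM (v : 'cV_n) : 0 <= dotv v (M *m v) by rewrite Mv !dotv_bilin subr_ge0.
have [C MC] : exists C, M *m C = 1%:M.
  apply: mulmx_solvable => v; rewrite symM Mv trmx1 mul1mx => Bv.
  apply/eqP/negPn/negP => v0; apply: nev; apply/(eigenvalue_symP _ symB).
  by exists v => //; apply/esym/subr0_eq.
have [k k0 Ck] := mulmx_bounded C.
(* This bounds <C v, v> / |v|^2, because 2 <C v, v> <= |C v|^2 + |v|^2. Cauchy-Schwarz for [M] at v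
   and C v then shows that [M] dominates c^-1 times the identity. *)
pose c := (k + 1) / 2; have c0 : 0 < c by rewrite /c; lra.
have Mc (v : 'cV_n) : dotv v v <= c * dotv v (M *m v).
  have [->|v0] := eqVneq v 0; first by rewrite !dotv0l mulr0.
  have vv : 0 < dotv v v by rewrite lt_def dotv_eq0 v0 dotv_ge0.
  have := psd_cauchy_schwarz symM psdM v (C *m v).
  rewrite mulmxA MC mul1mx => h1.
  have h2 : dotv (C *m v) v <= c * dotv v v.
    have := Ck v; have := dotv_ge0 (C *m v - v).
    by rewrite !dotv_bilin (dotvC v (C *m v)) /c; lra.
  rewrite -(ler_pM2r vv) -expr2 (le_trans h1)//.
  by rewrite mulrAC mulrC ler_wpM2r.
have : S (Num.max 0 (s - c^-1)).
  split; first by rewrite le_max lexx.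
  move=> v; apply: (@le_trans _ _ ((s - c^-1) * dotv v v)); last first.
    by rewrite ler_wpM2r ?dotv_ge0// le_max lexx orbT.
  have := Mc v; rewrite Mv !dotv_bilin mulrBl -ler_pdivrMl//; lra.
move=> /(ge_inf lbS); rewrite -/s le_max leNgt sp/=.
by have := c0; rewrite -invr_gt0; lra.
Qed.

(** Eigenvalues of [A^T *m A] are quotients |A v|^2 / |v|^2, so an operator bound dominates them;
    conversely the operator bound from [max_eigenvalue] is 0 or an eigenvalue. *)
Lemma sigma_max_leP (R : realType) (m n : nat) (A : 'M[R]_(m, n)) L : 0 <= L ->
  sigma_max A <= L <->
  forall v : 'cV[R]_n, dotv (A *m v) (A *m v) <= L ^+ 2 * dotv v v.
Proof.
move=> L0; pose B := A^T *m A.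
have symB : B^T = B by rewrite trmx_mul trmxK.
have BE (v : 'cV_n) : dotv v (B *m v) = dotv (A *m v) (A *m v).
  by rewrite [RHS]dotv_mulmx mulmxA.
have eig_le K a : (forall v : 'cV[R]_n, dotv v (B *m v) <= K * dotv v v) ->
    eigenvalue B a -> a <= K.
  move=> KB /(eigenvalue_symP _ symB)[v Bv v0]; have := KB v.
  by rewrite Bv dotvZr ler_pM2r// lt_def dotv_eq0 v0 dotv_ge0.
split=> AL; last first.
  rewrite /sigma_max; set E := (X in sup X).
  (* If there is no eigenvalue, as for n = 0, [sup] takes its default value 0. *)
  have [->|/set0P E0] := eqVneq E set0; first by rewrite sup0.
  apply: ge_sup => // _ [a /= aB <-].
  rewrite -(ger0_norm L0) -sqrtr_sqr ler_wsqrtr//.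
  by apply: eig_le aB => v; rewrite BE.
have [K K0 AK] := mulmx_bounded A.
have BK (v : 'cV_n) : dotv v (B *m v) <= K * dotv v v by rewrite BE.
have [s [s0 seig sB]] := max_eigenvalue symB (ex_intro _ K BK).
move=> v; rewrite -BE (le_trans (sB v))// ler_wpM2r ?dotv_ge0//.
case: seig => [->|seig]; first by rewrite sqr_ge0.
rewrite -(sqr_sqrtr s0) ler_sqr ?nnegrE ?sqrtr_ge0//; apply: le_trans AL.
apply: ub_le_sup; last by exists s.
exists (Num.sqrt K) => _ [a /= aB <-]; rewrite ler_wsqrtr//.
exact: eig_le aB.
Qed.

(** * Gradients *)

Section Gradient.
Variables (R : realType) (d : nat).
Implicit Types (f : 'cV[R]_d -> R) (g x y v : 'cV[R]_d).

Lemma dotv_is_linear g : linear (dotv g : 'cV[R]_d -> R).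
Proof. by move=> a u v; rewrite dotvDr dotvZr. Qed.

HB.instance Definition _ g :=
  GRing.isLinear.Build R 'cV[R]_d R _ (dotv g) (dotv_is_linear g).

Lemma continuous_dotv g : continuous (dotv g : 'cV[R]_d -> R).
Proof.
have -> : dotv g = \sum_i (fun v : 'cV[R]_d => g i 0 *: (v i 0 : R)).
  by apply/funext => v; rewrite dotvE fct_sumE.
move=> x; apply: differentiable_continuous; apply: differentiable_sum => i.
by apply: differentiableZ; exact: differentiable_coord.
Qed.

(** Passage to the sup norm, in which the library states differentiability. *)
Lemma dotv_le_sup_norm v : dotv v v <= d%:R * `|v| ^+ 2.
Proof.
have -> : d%:R * `|v| ^+ 2 = \sum_(i < d) `|v| ^+ 2.
  by rewrite sumr_const card_ord mulr_natl.
rewrite dotvE; apply: ler_sum => i _; rewrite -expr2 -real_normK ?num_real//.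
rewrite ler_sqr ?nnegrE// [X in _ <= X]/Num.norm/= mx_normrE.
by apply/bigmax_geP; right; exists (i, 0).
Qed.

(** A quadratic remainder is o(v), which yields the differential and the gradient at once. *)
Lemma quadratic_remainder_diff f x g c :
  (forall v, `|f (v + x) - (f x + dotv g v)| <= c * dotv v v) ->
  differentiable f x /\ grad f x = g.
Proof.
move=> H.
have fo : f \o shift x = cst (f x) + dotv g +o_ (0 : 'cV[R]_d) id.
  (* The added 1 keeps [K] positive when [c] or [d] is 0. *)
  apply/eqaddoP => e e0; pose K := `|c| * d%:R + 1.
  have K0 : 0 < K by rewrite ltr_wpDl// mulr_ge0.
  have := @nbhs0_le R 'cV[R]_d _ (divr_gt0 e0 K0); apply: filterS => v ve.
  apply: (le_trans (H v)).
  apply: (@le_trans _ _ (`|c| * (d%:R * `|v| ^+ 2))).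
    apply: le_trans (ler_wpM2l (normr_ge0 c) (dotv_le_sup_norm v)).
    by rewrite ler_wpM2r ?dotv_ge0// ler_norm.
  rewrite mulrA expr2 mulrA ler_wpM2r//.
  apply: (@le_trans _ _ (K * `|v|)); first by rewrite ler_wpM2r// lerDl.
  by rewrite mulrC -ler_pdivlMr.
have dfE := diff_unique (@continuous_dotv g) fo.
have df : differentiable f x.
  by apply/diff_locallyP; rewrite dfE; split => //; exact: continuous_dotv.
split=> //; apply/matrixP => i j; rewrite ord1 mxE deriveE//.
by rewrite dfE/= dotvC dotv_delta.
Qed.

Lemma derive_grad f x v : differentiable f x -> 'D_v f x = dotv (grad f x) v.
Proof.
move=> df; rewrite deriveE// [v in LHS]matrix_sum_delta exchange_big big_ord1/=.
rewrite linear_sum dotvE; apply: eq_bigr => i _; rewrite linearZ/= mxE deriveE//.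
by rewrite mulrC.
Qed.

Lemma is_derive_line f x v (t : R) : (forall z, differentiable f z) ->
  is_derive t 1 (fun s : R => f (x + s *: v)) (dotv (grad f (x + t *: v)) v).
Proof.
move=> df; rewrite -derive_grad//.
(* The difference quotients of the restriction at t are those of [f] at x + t v along v. *)
have E : (fun h : R => h^-1 *: (((fun s : R => f (x + s *: v)) \o shift t) (h *: 1)
            - f (x + t *: v))) =
         (fun h => h^-1 *: ((f \o shift (x + t *: v)) (h *: v) - f (x + t *: v))).
  apply/funext => h /=; congr (_ *: (f _ - _)).
  by rewrite [h *: 1]mulr1 scalerDl addrCA.
have : derivable f (x + t *: v) v by apply: diff_derivable.
by split; rewrite /derivable /derive E.
Qed.

End Gradient.

(** * Smooth convex functions *)

Lemma convex_functionP (R : realType) (d : nat) (f : 'cV[R]_d -> R) :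
  convex_function (E := 'cV[R]_d) setT f <->
  forall t x y, 0 <= t <= 1 -> f (t *: x + (1 - t) *: y) <= t * f x + (1 - t) * f y.
Proof.
split=> [cf t x y t01|cf t x y _ _]; last first.
  by apply: cf; rewrite ge0 le1.
have := cf (Itv01 (proj1 (andP t01)) (proj2 (andP t01))) x y.
by rewrite !in_setT; apply.
Qed.

Section SmoothConvex.
Variables (R : realType) (d : nat).
Implicit Types (h p : 'cV[R]_d -> R) (G : 'cV[R]_d -> 'cV[R]_d) (x y v : 'cV[R]_d).

(** Convexity and l-smoothness in a form free of derivatives; [smooth_convex_classF] turns [G] into
    a gradient. *)
Definition smooth_convex (l : R) h G := forall x v,
  dotv (G x) v <= h (x + v) - h x <= dotv (G x) v + l / 2 * dotv v v.

Lemma smooth_convex_interp (l : R) h G x y : 0 < l -> smooth_convex l h G ->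
  h y + dotv (G y) (x - y) + (2 * l)^-1 * dotv (G x - G y) (G x - G y) <= h x.
Proof.
(* [z] minimises <g, v> + l/2 |v|^2 over v, with minimum -|g|^2/2l. *)
move=> l0 hG; pose g : 'cV[R]_d := G x - G y; pose z : 'cV[R]_d := - l^-1 *: g.
have /andP[_] := hG x z; have /andP[+ _] := hG y (x - y + z).
have -> : y + (x - y + z) = x + z by rewrite addrA addrCA subrr addr0.
have -> : l / 2 * dotv z z = (2 * l)^-1 * dotv g g.
  by rewrite /z !dotv_bilin; field; rewrite gt_eqF.
have gz : dotv (G x) z - dotv (G y) z = - 2 * ((2 * l)^-1 * dotv g g).
  rewrite -dotvNl -dotvDl -/g /z dotvZr; field; rewrite gt_eqF//.
by rewrite (dotvDr (G y) (x - y) z) -/g; lra.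
Qed.

(** The interpolation inequality added to its mirror image gives cocoercivity, |G x - G y|^2 / l <=
    <G x - G y, x - y>; Cauchy-Schwarz concludes. *)
Lemma smooth_convex_lipschitz (l : R) h G x y : 0 < l -> smooth_convex l h G ->
  norm2 (G x - G y) <= l * norm2 (x - y).
Proof.
move=> l0 hG; have := smooth_convex_interp x y l0 hG.
have := smooth_convex_interp y x l0 hG.
rewrite -(opprB x y) -(opprB (G x) (G y)) !dotvNl !dotvNr opprK => h1 h2.
have h3 : (2 * l)^-1 * dotv (G x - G y) (G x - G y) * 2 <= dotv (G x - G y) (x - y).
  by rewrite (dotvDl _ _ (x - y)) dotvNl; lra.
have := le_trans h3 (dotv_le_norm2 _ _).
rewrite -norm2_sqr; have := norm2_ge0 (G x - G y).
rewrite le_eqVlt => /predU1P[<- _|g0]; first by rewrite mulr_ge0 ?norm2_ge0 ?ltW.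
rewrite [X in X <= _](_ : _ = norm2 (G x - G y) * (l^-1 * norm2 (G x - G y))); last first.
  by field; rewrite gt_eqF.
by rewrite ler_pM2l// ler_pdivrMl.
Qed.

(** Descent lemma, by the mean value theorem: [F] has derivative <grad p (x + t v) - grad p x, v> -
    t L |v|^2, nonpositive on [0, 1]. *)
Lemma lipschitz_grad_upper (L : R) p x v :
  (forall z, differentiable p z) ->
  (forall y z, norm2 (grad p y - grad p z) <= L * norm2 (y - z)) ->
  p (x + v) - p x <= dotv (grad p x) v + L / 2 * dotv v v.
Proof.
move=> dp lip; pose a := dotv (grad p x) v; pose b := L / 2 * dotv v v.
pose F := (fun t : R => p (x + t *: v)) - (a \*: (@id R)) - (b \*: (@id R ^+ 2)).
pose dF t := dotv (grad p (x + t *: v)) v - a - 2 * b * t.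
have FdF (t : R) : is_derive t 1 F (dF t).
  have := is_derive_line x v t dp => ?.
  by apply: is_derive_eq; rewrite /dF /= !scaler1 /GRing.scale/=; ring.
have cF : ({within `[0, 1], continuous F})%classic.
  by apply: derivable_within_continuous => t _; case: (FdF t).
have [c] := MVT ltr01 (fun t _ => FdF t) cF.
rewrite in_itv/= => /andP[c0 _].
have -> : F 1 - F 0 = p (x + v) - p x - a - b.
  rewrite /F !fctE /= !scale1r scale0r addr0 /GRing.scale/=; ring.
have : dF c <= 0.
  have := dotv_le_norm2 (grad p (x + c *: v) - grad p x) v.
  have := ler_wpM2r (norm2_ge0 v) (lip (x + c *: v) x).
  rewrite [x + _ - x]addrC addKr norm2Z ?(ltW c0)// /dF /a /b -norm2_sqr.
  by rewrite (dotvDl (grad p (x + c *: v))) dotvNl; lra.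
by rewrite subr0 mulr1 /a /b; lra.
Qed.

(** Convexity on the segment from x to x + v bounds the difference quotients; t then tends to 0 from
    the right. *)
Lemma strongly_convex_lower (mu : R) p x v :
  differentiable p x ->
  convex_function (E := 'cV[R]_d) setT
    (fun x : 'cV[R]_d => p x - mu / 2 * norm2 x ^+ 2) ->
  dotv (grad p x) v + mu / 2 * dotv v v <= p (x + v) - p x.
Proof.
move=> dp /convex_functionP cp; pose c := mu / 2 * dotv v v.
have q (t : R) : 0 < t <= 1 ->
    t^-1 *: (p (x + t *: v) - p x) <= p (x + v) - p x - c + t * c.
  move=> /andP[t0 t1]; have := cp t (x + v) x; rewrite ltW// t1 => /(_ isT).
  rewrite -[t *: (x + v) + _](_ : x + t *: v = _); last first.
    by rewrite scalerDr scalerBl scale1r [RHS]addrC addrA subrK.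
  rewrite !norm2_sqr !dotv_bilin (dotvC v x) /GRing.scale/= ler_pdivrMl// /c.
  by nra.
have pv : derivable p x v by exact: diff_derivable.
have cvg1 : ((fun t : R => t^-1 *: (p (x + t *: v) - p x)) @ 0^'+ --> dotv (grad p x) v)%classic.
  rewrite -derive_grad//.
  have -> : (fun t : R => t^-1 *: (p (x + t *: v) - p x)) =
    (fun h : R => h^-1 *: ((p \o shift x) (h *: v) - p x)).
    by apply/funext => h /=; rewrite (addrC x).
  exact: cvg_dnbhs_at_right.
have cvg2 : ((fun t : R => p (x + v) - p x - c + t * c) @ 0^'+ --> p (x + v) - p x - c)%classic.
  rewrite -[X in (_ --> X)%classic]addr0 -[X in (_ --> _ + X)%classic](mul0r c).
  apply: cvgD; first exact: cvg_cst.
  apply: cvgM; last exact: cvg_cst.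
  by apply: cvg_at_right_filter; exact: cvg_id.
rewrite -lerBrDr; apply: ler_cvg_to cvg1 cvg2 _.
near=> t; apply: q; apply/andP; split; near: t.
- exact: nbhs_right_gt.
- exact: nbhs_right_le.
Unshelve. all: by end_near. Qed.

Lemma classF_smooth_convex (mu L : R) p : classF mu L p ->
  smooth_convex (L - mu) (fun x => p x - mu / 2 * dotv x x)
    (fun x => grad p x - mu *: x).
Proof.
move=> [cp dp lip] x v; apply/andP.
have := strongly_convex_lower v (dp x) cp; have := lipschitz_grad_upper x v dp lip.
by rewrite !dotv_bilin (dotvC v x); split; lra.
Qed.

(** The remainder lies between mu/2 |v|^2 and (l + mu)/2 |v|^2, as [quadratic_remainder_diff]
    requires. *)
Lemma smooth_convex_remainder (mu l : R) h G x v : 0 <= mu ->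
  smooth_convex l h G ->
  `|h (v + x) + mu / 2 * dotv (v + x) (v + x)
    - (h x + mu / 2 * dotv x x + dotv (G x + mu *: x) v)| <= (l + mu) / 2 * dotv v v.
Proof.
move=> mu0 hG; have /andP[] := hG x v; have := mulr_ge0 mu0 (dotv_ge0 v).
rewrite [x + v]addrC ler_norml !dotv_bilin (dotvC v x) => h1 h2 h3.
by apply/andP; split; lra.
Qed.

(** Undoes the shift by mu/2 |.|^2; the constant mu + l comes from the triangle inequality for mu (x
    - y) and G x - G y. *)
Lemma smooth_convex_classF (mu l : R) h G : 0 <= mu -> 0 < l ->
  convex_function (E := 'cV[R]_d) setT h -> smooth_convex l h G ->
  classF mu (mu + l) (fun x => h x + mu / 2 * dotv x x) /\
  forall x, grad (fun z => h z + mu / 2 * dotv z z) x = G x + mu *: x.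
Proof.
move=> mu0 l0 ch hG; set p := fun z => h z + _.
have dp x : differentiable p x /\ grad p x = G x + mu *: x.
  apply: quadratic_remainder_diff => v; exact: smooth_convex_remainder.
split=> [|x]; last exact: (dp x).2.
split=> [|x|x y]; last 2 first.
- exact: (dp x).1.
- rewrite !(dp _).2.
  rewrite [X in norm2 X](_ : _ = mu *: (x - y) + (G x - G y)); last first.
    by rewrite scalerBr opprD addrACA addrC.
  rewrite (le_trans (norm2D _ _))// norm2Z// mulrDl lerD2l.
  exact: smooth_convex_lipschitz hG.
rewrite [X in convex_function _ X](_ : _ = h)//.
by apply/funext => x; rewrite norm2_sqr addrK.
Qed.

End SmoothConvex.

(** * The smooth convex interpolant *)

Lemma ler_eps_mul (R : realFieldType) (a b c : R) : 0 <= c ->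
  (forall t, 0 < t -> a <= b + t * c) -> a <= b.
Proof.
move=> c0 H; apply/ler_addgt0Pr => e e0.
have c1 : 0 < c + 1 by rewrite ltr_wpDl.
apply: (le_trans (H (e / (c + 1)) (divr_gt0 e0 c1))).
rewrite lerD2l mulrAC ler_pdivrMr// ler_wpM2l ?ltW//; lra.
Qed.

(** [x] is a convex combination of x + v and x - t v. Convexity of l/2 |.|^2 - h bounds h (x + v)
    above through h (x - t v), which the subgradient bounds below; then t tends to 0. *)
Lemma subgradient_smooth_convex (R : realType) (d : nat) (l : R)
    (h : 'cV[R]_d -> R) (G : 'cV[R]_d -> 'cV[R]_d) : 0 <= l ->
  (forall x v, h x + dotv (G x) v <= h (x + v)) ->
  (forall t x y, 0 <= t <= 1 ->
    l / 2 * dotv (t *: x + (1 - t) *: y) (t *: x + (1 - t) *: y)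
      - h (t *: x + (1 - t) *: y) <=
    t * (l / 2 * dotv x x - h x) + (1 - t) * (l / 2 * dotv y y - h y)) ->
  smooth_convex l h G.
Proof.
move=> l0 sub ck x v; apply/andP; split; first by rewrite lerBrDl sub.
rewrite lerBlDr; apply: (@ler_eps_mul _ _ _ (l / 2 * dotv v v)) => [|t t0].
  by rewrite mulr_ge0 ?dotv_ge0// divr_ge0.
have t1 : 0 < 1 + t by rewrite ltr_wpDl// ltW.
have t1n : 1 + t != 0 by rewrite gt_eqF.
(* The weight for which s v = (1 - s) t v. *)
pose s := t / (1 + t).
have s01 : 0 <= s <= 1.
  by rewrite divr_ge0 ?(ltW t0) ?(ltW t1)//= ler_pdivrMr// mul1r lerDr ler01.
have stE P Q : (1 + t) * (s * P + (1 - s) * Q) = t * P + Q by rewrite /s; field.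
have := ck s (x + v) (x - t *: v) s01; have := sub x (- (t *: v)).
have -> : s *: (x + v) + (1 - s) *: (x - t *: v) = x.
  rewrite scalerDr (scalerBr _ x) addrACA -scalerDl subrKC scale1r scalerA.
  by rewrite -scalerBl {1}/s (_ : _ - _ = 0) ?scale0r ?addr0// /s; field.
rewrite !dotv_bilin (dotvC v x) => h1 /(ler_wpM2l (ltW t1)).
by rewrite stE => h2; rewrite -(ler_pM2l t0); lra.
Qed.

Section Interpolant.
Variables (R : realType) (d : nat) (I : finType) (l : R).
Variables (x g : I -> 'cV[R]_d) (f : I -> R).
Hypothesis l_gt0 : 0 < l.
Hypothesis f_ge : forall i j,
  f j + dotv (g j) (x i - x j) + (2 * l)^-1 * dotv (g i - g j) (g i - g j) <= f i.

Implicit Types (a b : 'rV[R]_#|I|) (y z v : 'cV[R]_d).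

(** Written as a closed slice of a cube, whence compactness; row vectors fit the extreme value
    theorem. *)
Definition simplex : set 'rV[R]_#|I| :=
  [set a | (forall k, 0 <= a 0 k <= 1) /\ \sum_i a 0 (enum_rank i) = 1]%classic.

Definition mixed_grad a : 'cV[R]_d := \sum_i a 0 (enum_rank i) *: g i.

Definition mixed_cst a : R := \sum_i a 0 (enum_rank i) *
  (f i - dotv (g i) (x i) + (2 * l)^-1 * dotv (g i) (g i)).

(* Lagrangian dual of the Moreau envelope of the piecewise affine function
   max_i (f i + <g i, . - x i> + |g i|^2 / 2l); its maximum over the simplex is
   the interpolant. *)
Definition mixed_minorant z a : R :=
  mixed_cst a + dotv (mixed_grad a) z
  - (2 * l)^-1 * dotv (mixed_grad a) (mixed_grad a).

Lemma mixed_gradP t a b :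
  mixed_grad (t *: a + (1 - t) *: b) = t *: mixed_grad a + (1 - t) *: mixed_grad b.
Proof.
rewrite /mixed_grad !scaler_sumr -big_split/=; apply: eq_bigr => i _.
by rewrite !mxE !scalerA -scalerDl.
Qed.

Lemma mixed_cstP t a b :
  mixed_cst (t *: a + (1 - t) *: b) = t * mixed_cst a + (1 - t) * mixed_cst b.
Proof.
rewrite /mixed_cst !mulr_sumr -big_split/=; apply: eq_bigr => i _.
by rewrite !mxE; ring.
Qed.

Lemma simplex_convex t a b : 0 <= t <= 1 -> simplex a -> simplex b ->
  simplex (t *: a + (1 - t) *: b).
Proof.
move=> /andP[t0 t1] [a01 asum] [b01 bsum]; split=> [k|].
  rewrite !mxE; have := a01 k; have := b01 k => /andP[? ?] /andP[? ?].
  by apply/andP; split; nra.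
under eq_bigr do rewrite !mxE.
by rewrite big_split/= -!mulr_sumr asum bsum; ring.
Qed.

Lemma simplex_vertex i : simplex (delta_mx 0 (enum_rank i)).
Proof.
split=> [k|].
  by rewrite mxE eqxx; case: eqP => _ /=; rewrite ?ler01 ?lexx.
rewrite (bigD1 i)//= mxE !eqxx/= big1 ?addr0// => j ji.
by rewrite mxE eqxx (inj_eq enum_rank_inj) (negbTE ji).
Qed.

Lemma mixed_grad_vertex i : mixed_grad (delta_mx 0 (enum_rank i)) = g i.
Proof.
rewrite /mixed_grad (bigD1 i)//= mxE !eqxx/= scale1r big1 ?addr0// => j ji.
by rewrite mxE eqxx (inj_eq enum_rank_inj) (negbTE ji) scale0r.
Qed.

Lemma mixed_cst_vertex i : mixed_cst (delta_mx 0 (enum_rank i)) =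
  f i - dotv (g i) (x i) + (2 * l)^-1 * dotv (g i) (g i).
Proof.
rewrite /mixed_cst (bigD1 i)//= mxE !eqxx/= mul1r big1 ?addr0// => j ji.
by rewrite mxE eqxx (inj_eq enum_rank_inj) (negbTE ji) mul0r.
Qed.

Lemma mixed_minorantD z v a :
  mixed_minorant (z + v) a = mixed_minorant z a + dotv (mixed_grad a) v.
Proof. by rewrite /mixed_minorant dotvDr; ring. Qed.

Lemma mixed_minorant_convl t y z a :
  mixed_minorant (t *: y + (1 - t) *: z) a =
  t * mixed_minorant y a + (1 - t) * mixed_minorant z a.
Proof. by rewrite /mixed_minorant !dotv_bilin; ring. Qed.

(** Joint concavity: up to a term linear in [a] the expression is -|mixed_grad a - l z|^2 / 2l, so
    the gap is an explicit square. *)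
Lemma mixed_minorant_conv t y z a b : 0 <= t <= 1 ->
  t * (mixed_minorant y a - l / 2 * dotv y y)
    + (1 - t) * (mixed_minorant z b - l / 2 * dotv z z) <=
  mixed_minorant (t *: y + (1 - t) *: z) (t *: a + (1 - t) *: b)
    - l / 2 * dotv (t *: y + (1 - t) *: z) (t *: y + (1 - t) *: z).
Proof.
move=> /andP[t0 t1]; rewrite /mixed_minorant mixed_gradP mixed_cstP.
set r := mixed_grad a; set s := mixed_grad b.
have := dotv_ge0 (r - s - l *: (y - z)); set D := dotv _ _ => D0.
rewrite -subr_ge0 [X in 0 <= X](_ : _ = t * (1 - t) / (2 * l) * D); last first.
  rewrite /D !dotv_bilin (dotvC z y) (dotvC s r) (dotvC y r) (dotvC z r) (dotvC y s) (dotvC z s).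
  by field; rewrite gt_eqF.
by rewrite mulr_ge0// divr_ge0 ?mulr_ge0 ?subr_ge0// ltW.
Qed.

Lemma mixed_minorant_vertex i : mixed_minorant (x i) (delta_mx 0 (enum_rank i)) = f i.
Proof. by rewrite /mixed_minorant mixed_grad_vertex mixed_cst_vertex; ring. Qed.

(** The average of [f_ge i j] over [j] with weights [a]; expanding the squares turns its left side
    into exactly this one. *)
Lemma mixed_minorant_le i a : simplex a ->
  mixed_minorant (x i) a + (2 * l)^-1 * dotv (g i - mixed_grad a) (g i - mixed_grad a) <= f i.
Proof.
move=> [a01 asum].
have sum_cst c : \sum_j a 0 (enum_rank j) * c = c by rewrite -mulr_suml asum mul1r.
have : \sum_j a 0 (enum_rank j) *
    (f j + dotv (g j) (x i - x j) + (2 * l)^-1 * dotv (g i - g j) (g i - g j)) <= f i.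
  rewrite -[X in _ <= X]sum_cst; apply: ler_sum => j _.
  by apply: ler_wpM2l (f_ge i j); have /andP[] := a01 (enum_rank j).
apply: le_trans; rewrite le_eqVlt; apply/orP; left; apply/eqP.
pose q := (2 * l)^-1.
transitivity (mixed_cst a + dotv (mixed_grad a) (x i)
    + q * (dotv (g i) (g i) - 2 * dotv (mixed_grad a) (g i))).
  by rewrite /mixed_minorant -/q !dotv_bilin (dotvC (g i) (mixed_grad a)); ring.
rewrite /mixed_cst /mixed_grad !dotv_suml -[dotv (g i) (g i)]sum_cst.
rewrite [2 * \sum_i _]mulr_sumr -sumrB mulr_sumr -!big_split/=.
by apply: eq_bigr => j _; rewrite -/q !dotv_bilin (dotvC (g i) (g j)); ring.
Qed.

Lemma continuous_coord_sum (w : I -> R) :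
  continuous (fun a : 'rV[R]_#|I| => \sum_i a 0 (enum_rank i) * w i).
Proof.
apply: continuous_big => [|i _]; first exact: add_continuous.
have ca := @coord_continuous R 1 #|I| 0 (enum_rank i).
have cb : continuous (cst (w i) : 'rV[R]_#|I| -> R) by exact: cst_continuous.
by move=> a; exact: continuousM (ca a) (cb a).
Qed.

Lemma simplex_compact : compact simplex.
Proof.
have -> : simplex = ([set a : 'rV[R]_#|I| | forall k, `[0, 1]%classic (a 0 k)]
    `&` (fun a : 'rV[R]_#|I| => \sum_i a 0 (enum_rank i)) @^-1` [set 1])%classic.
  by apply/seteqP; split=> a [a01 asum]; split=> // k; have := a01 k; rewrite /= in_itv.
apply: compact_closedI.
  have := @rV_compact R #|I| (fun=> `[0, 1]%classic) (fun=> @segment_compact R 0 1).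
  exact.
apply: closed_comp; last exact: closed_eq.
move=> a _; have := @continuous_coord_sum (fun=> 1) a.
by under eq_fun do under eq_bigr do rewrite mulr1.
Qed.

Lemma continuous_mixed_minorant z : continuous (mixed_minorant z).
Proof.
have cg y : continuous (fun a => dotv (mixed_grad a) y).
  rewrite (_ : (fun _ => _) = fun a : 'rV[R]_#|I| => \sum_i a 0 (enum_rank i) * dotv (g i) y).
    exact: continuous_coord_sum.
  by apply/funext => a; rewrite dotv_suml; apply: eq_bigr => i _; rewrite dotvZl.
have cgg : continuous (fun a => dotv (mixed_grad a) (mixed_grad a)).
  rewrite (_ : (fun _ => _) = fun a =>
    \sum_k dotv (mixed_grad a) (delta_mx k 0) * dotv (mixed_grad a) (delta_mx k 0)).
    apply: continuous_big => [|k _ a]; first exact: add_continuous.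
    exact: continuousM (cg _ a) (cg _ a).
  by apply/funext => a; rewrite dotvE; apply: eq_bigr => k _; rewrite dotvC dotv_delta.
have cq : continuous (cst (2 * l)^-1 : 'rV[R]_#|I| -> R) by exact: cst_continuous.
have cc : continuous mixed_cst by exact: continuous_coord_sum.
move=> a; exact: continuousB (continuousD (cc a) (cg z a)) (continuousM (cq a) (cgg a)).
Qed.

Lemma mixed_minorant_max : I -> forall z, exists2 a, simplex a &
  forall b, simplex b -> mixed_minorant z b <= mixed_minorant z a.
Proof.
move=> i z; have [||a] := EVT_max_rV _ simplex_compact (f := mixed_minorant z).
- by exists (delta_mx 0 (enum_rank i)); exact: simplex_vertex.
- exact/continuous_subspaceT/continuous_mixed_minorant.
by rewrite inE => aS amax; exists a => // b bS; apply: amax; rewrite inE.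
Qed.

Lemma smooth_convex_interpolation : I -> exists h G,
  [/\ convex_function (E := 'cV[R]_d) setT h, smooth_convex l h G &
      forall i, h (x i) = f i /\ G (x i) = g i].
Proof.
move=> i0; have max_ex z : exists a, simplex a /\
    forall b, simplex b -> mixed_minorant z b <= mixed_minorant z a.
  by have [a aS amax] := mixed_minorant_max i0 z; exists a.
(* One maximiser is fixed at each point; its mixed gradient is a subgradient of [h] there. *)
have [a aP] := choice max_ex.
have aS z := (aP z).1; have amax z := (aP z).2.
pose h z := mixed_minorant z (a z); pose G z := mixed_grad (a z).
exists h, G; split.
- apply/convex_functionP => t y z /andP[t0 t1]; rewrite /h mixed_minorant_convl.
  by rewrite lerD// ler_wpM2l ?subr_ge0//; apply: amax.
- apply: subgradient_smooth_convex => [|y v|t y z t01]; first exact: ltW.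
    by rewrite -mixed_minorantD; exact: amax.
  have := mixed_minorant_conv y z (a y) (a z) t01.
  have := amax (t *: y + (1 - t) *: z) _ (simplex_convex t01 (aS y) (aS z)).
  by rewrite -/(h _) -/(h y) -/(h z); lra.
(* Vertex i gives f i <= h (x i), and [mixed_minorant_le] gives h (x i) + D / 2l <= f i. Hence
   equality and D = 0, that is G (x i) = g i. *)
- move=> i; have := amax (x i) _ (simplex_vertex i); rewrite mixed_minorant_vertex.
  have := mixed_minorant_le i (aS (x i)); have := dotv_ge0 (g i - G (x i)).
  set D := dotv _ _ => D0; rewrite -/(h _) => h1 h2.
  have q0 : 0 < (2 * l)^-1 by rewrite invr_gt0 mulr_gt0.
  have qD := mulr_ge0 (ltW q0) D0.
  have hf : h (x i) = f i by lra.
  split=> //; apply/esym/eqP; rewrite -subr_eq0 -dotv_eq0 -/D.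
  have /eqP : (2 * l)^-1 * D = 0 by rewrite /D; lra.
  by rewrite mulf_eq0 gt_eqF.
Qed.

End Interpolant.

(** * The interpolation conditions *)

Section ClassF.
Variables (R : realType) (d : nat) (mu L : R).
Hypotheses (mu_ge0 : 0 <= mu) (mu_lt : mu < L).
Implicit Types (x g : 'cV[R]_d) (p : 'cV[R]_d -> R).

(** Both inequalities have the same slack: subtracting mu/2 |.|^2 replaces (mu, L) by (0, L -
    mu). *)
Lemma interpF_shift x g f x' g' f' : interpF mu L x g f x' g' f' <->
  (f' - mu / 2 * dotv x' x') + dotv (g' - mu *: x') (x - x')
    + (2 * (L - mu))^-1 * dotv ((g - mu *: x) - (g' - mu *: x'))
                               ((g - mu *: x) - (g' - mu *: x'))
  <= f - mu / 2 * dotv x x.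
Proof.
have L0 : L != 0 by rewrite gt_eqF// (le_lt_trans mu_ge0).
have Lmu : L - mu != 0 by rewrite subr_eq0 gt_eqF.
have ge0_iff (a b : R) : a = b -> (0 <= a <-> 0 <= b) by move=> ->.
rewrite /interpF -subr_ge0 -[X in _ <-> is_true X]subr_ge0 !norm2_sqr; apply: ge0_iff.
rewrite !dotv_bilin (dotvC x' x) (dotvC g' g) (dotvC x g) (dotvC x' g).
rewrite (dotvC x g') (dotvC x' g'); field.
by rewrite L0 Lmu.
Qed.

Lemma classF_interpF p x y : classF mu L p ->
  interpF mu L x (grad p x) (p x) y (grad p y) (p y).
Proof.
move=> /classF_smooth_convex/(smooth_convex_interp x y) H.
by apply/interpF_shift/H; rewrite subr_gt0.
Qed.

Lemma classF_interpolation (I : finType) (x g : I -> 'cV[R]_d) (f : I -> R) : I ->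
  (forall i j, interpF mu L (x i) (g i) (f i) (x j) (g j) (f j)) ->
  exists p, classF mu L p /\ forall i, p (x i) = f i /\ grad p (x i) = g i.
Proof.
move=> i0 fg; have l0 : 0 < L - mu by rewrite subr_gt0.
have [h [G [ch hG hf]]] := smooth_convex_interpolation l0
  (fun i j => (interpF_shift _ _ _ _ _ _).1 (fg i j)) i0.
have [] := smooth_convex_classF mu_ge0 l0 ch hG; rewrite subrKC => pF pG.
eexists; split; first exact: pF.
by move=> i; rewrite pG (hf i).1 (hf i).2 !subrK.
Qed.

(** Covers both partial gradients, with s = 1 for p and s = -1 for q. The remainder is [s] times
    that of [p], which the two tangent bounds control. *)
Lemma classF_grad_affine p x g (s c : R) : classF mu L p ->
  grad (fun z => s * p z + dotv g z + c) x = s *: grad p x + g.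
Proof.
move=> [cp dp lip]; apply: (quadratic_remainder_diff (c := `|s| * (L / 2)) _).2 => v.
have -> : s * p (v + x) + dotv g (v + x) + c
    - (s * p x + dotv g x + c + dotv (s *: grad p x + g) v) =
    s * (p (x + v) - p x - dotv (grad p x) v).
  by rewrite (addrC v) !dotv_bilin; ring.
rewrite normrM -mulrA ler_wpM2l//.
have := strongly_convex_lower v (dp x) cp; have := lipschitz_grad_upper x v dp lip.
have := mulr_ge0 mu_ge0 (dotv_ge0 v).
have : 0 <= L * dotv v v by rewrite mulr_ge0 ?dotv_ge0// (le_trans mu_ge0)// ltW.
by rewrite ler_norml => h1 h2 h3 h4; apply/andP; split; lra.
Qed.

End ClassF.

(** * Column matrices and Gram inequalities *)

Section Columns.
Variables (R : realType) (I : finType).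

Lemma col_colsmx (d : nat) (v : I -> 'cV[R]_d) i : col (enum_rank i) (colsmx v) = v i.
Proof. by apply/matrixP => k j; rewrite !mxE enum_rankK ord1. Qed.

Lemma colsmx_mulmx (m n : nat) (A : 'M[R]_(m, n)) (v : I -> 'cV[R]_n) :
  colsmx (fun i => A *m v i) = A *m colsmx v.
Proof.
apply/matrixP => k j; rewrite !mxE; apply: eq_bigr => l _.
by rewrite mxE.
Qed.

Lemma mulmx_colsmx (m n : nat) (A : 'M[R]_(m, n)) (v : I -> 'cV[R]_n)
    (w : I -> 'cV[R]_m) i :
  A *m colsmx v = colsmx w -> A *m v i = w i.
Proof. by move=> Avw; rewrite -(col_colsmx v) -(col_colsmx w) -Avw !colE mulmxA. Qed.

End Columns.

(** The quadratic form of the difference is c |B v|^2 - |A v|^2, and Gram matrices are symmetric. *)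
Lemma loewner_gramP (R : realType) (m n k : nat) (c : R)
    (A : 'M[R]_(m, k)) (B : 'M[R]_(n, k)) :
  loewner_le (A^T *m A) (c *: (B^T *m B)) <->
  forall v : 'cV[R]_k, dotv (A *m v) (A *m v) <= c * dotv (B *m v) (B *m v).
Proof.
have E (v : 'cV_k) : (v^T *m (c *: (B^T *m B) - A^T *m A) *m v) 0 0 =
    c * dotv (B *m v) (B *m v) - dotv (A *m v) (A *m v).
  rewrite -mulmxA -/(dotv v _) mulmxBl -scalemxAl !dotv_bilin !dotv_mulmx.
  by rewrite !mulmxA.
split=> [[_ H] v|H]; first by rewrite -subr_ge0 -E.
split=> [|v]; last by rewrite E subr_ge0.
by rewrite linearB/= linearZ/= !trmx_mul !trmxK.
Qed.

Lemma bilinear_formE (R : realType) (m n : nat) (A : 'M[R]_(m, n)) x y :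
  (y^T *m A *m x) 0 0 = dotv (A^T *m y) x.
Proof. by rewrite /dotv trmx_mul trmxK. Qed.

Theorem theorem3p17 (R : realType) (dx dy : nat) (mux muy Lx Ly Lxy : R)
    (hmux : 0 <= mux) (hLx : mux < Lx) (hmuy : 0 <= muy) (hLy : muy < Ly)
    (hLxy : 0 <= Lxy)
    (I : finType) (hI : (0 < #|I|)%N)
    (x : I -> 'cV[R]_dx) (y : I -> 'cV[R]_dy)
    (gx : I -> 'cV[R]_dx) (gy : I -> 'cV[R]_dy) (fv : I -> R) :
  interpolable mux muy Lx Ly Lxy x y gx gy fv <->
  exists (hx phix : I -> 'cV[R]_dx) (hy phiy : I -> 'cV[R]_dy)
         (fx fy : I -> R),
    (forall i, [/\ fv i = fx i + dotv (hx i) (x i) - fy i,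
                   gx i = phix i + hx i &
                   gy i = hy i - phiy i]) /\
    (forall i j,
       interpF mux Lx (x i) (phix i) (fx i) (x j) (phix j) (fx j)) /\
    (forall i j,
       interpF muy Ly (y i) (phiy i) (fy i) (y j) (phiy j) (fy j)) /\
    let X := colsmx x in let Y := colsmx y in
    let Hx := colsmx hx in let Hy := colsmx hy in
    [/\ Hx^T *m X = Y^T *m Hy,
        loewner_le (Hx^T *m Hx) (Lxy ^+ 2 *: (Y^T *m Y)) &
        loewner_le (Hy^T *m Hy) (Lxy ^+ 2 *: (X^T *m X))].
Proof.
(* With one variable frozen, [f] is p or -q plus an affine function. *)
have grads f p q (A : 'M[R]_(dy, dx)) i : classF mux Lx p -> classF muy Ly q ->
    (forall u v, f (u, v) = p u + (v^T *m A *m u) 0 0 - q v) ->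
    [/\ grad (fun u => f (u, y i)) (x i) = grad p (x i) + A^T *m y i,
        grad (fun v => f (x i, v)) (y i) = A *m x i - grad q (y i) &
        f (x i, y i) = p (x i) + dotv (A^T *m y i) (x i) - q (y i)].
  move=> pF qF fE; split; last by rewrite fE bilinear_formE.
  - rewrite -[grad p _]scale1r -(classF_grad_affine hmux hLx _ _ _ (- q (y i)) pF).
    by congr grad; apply/funext => u; rewrite fE bilinear_formE mul1r.
  - rewrite addrC -scaleN1r -(classF_grad_affine hmuy hLy _ _ _ (p (x i)) qF).
    congr grad; apply/funext => v.
    by rewrite fE bilinear_formE dotv_mulmx trmxK dotvC; ring.
split=> [[f [[p [q [A [pF qF AL fE]]]] data]]|].
  (* The coupling enters as h^x_i = A^T y_i and h^y_i = A x_i. *)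
  exists (fun i => A^T *m y i), (fun i => grad p (x i)), (fun i => A *m x i),
    (fun i => grad q (y i)), (fun i => p (x i)), (fun i => q (y i)).
  split; first by move=> i; have [-> -> ->] := data i; have [-> -> ->] := grads f p q A i pF qF fE.
  split; first by move=> i j; exact: classF_interpF.
  split; first by move=> i j; exact: classF_interpF.
  have AK := (sigma_max_leP A hLxy).1 AL.
  rewrite !colsmx_mulmx; split.
  (* Both sides are Y^T A X. *)
  - by rewrite trmx_mul trmxK mulmxA.
  - apply/loewner_gramP => v; rewrite -mulmxA.
    by apply: trmx_contraction AK _; exact: sqr_ge0.
  - by apply/loewner_gramP => v; rewrite -mulmxA.
move=> [hx [phix [hy [phiy [fx [fy [data [ineqx [ineqy]]]]]]]]].
move=> [XY /loewner_gramP HxY /loewner_gramP HyX].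
(* An index is needed to make the simplices of weights nonempty. *)
have /card_gt0P[i0 _] := hI.
have [p [pF pE]] := classF_interpolation hmux hLx i0 ineqx.
have [q [qF qE]] := classF_interpolation hmuy hLy i0 ineqy.
have [A [AX AY AK]] := contraction_interpolation hLxy XY HxY HyX.
pose f z := p z.1 + (z.2^T *m A *m z.1) 0 0 - q z.2.
exists f; split.
  by exists p, q, A; split=> //; apply/sigma_max_leP.
move=> i; have [-> -> ->] := grads f p q A i pF qF (fun _ _ => erefl).
(* Read column by column, [A] sends x_i to h^y_i and [A^T] sends y_i to h^x_i. *)
rewrite (mulmx_colsmx i AX) (mulmx_colsmx i AY).
by rewrite (pE i).1 (pE i).2 (qE i).1 (qE i).2; have [-> -> ->] := data i.
Qed.
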